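(* Let $A$ and $D$ be constants. The system $$\mathbb{R}_1:=\rho u_x+\rho_x u+\rho_t=0,\qquad \mathbb{R}_2:=u_t+uu_x+\frac{A\rho_x}{\rho}-\frac{D u_{xx}}{\rho}=0$$ for the unknown functions $\rho(x,t)$ and $u(x,t)$ is nonlinearly self-adjoint.
   Context: Introduce new dependent variables $h(x,t)$, $g(x,t)$ and the formal Lagrangian $L=h\,\mathbb{R}_1+g\,\mathbb{R}_2$. With $\frac{\delta}{\delta w}=\frac{\partial}{\partial w}-D_t\frac{\partial}{\partial w_t}-D_x\frac{\partial}{\partial w_x}+D_x^2\frac{\partial}{\partial w_{xx}}+D_xD_t\frac{\partial}{\partial w_{xt}}+D_t^2\frac{\partial}{\partial w_{tt}}+\cdots$ the Euler–Lagrange operator ($w=u$ or $w=\rho$; $D_x,D_t$ total derivatives), the adjoint expressions are $$S_1=\frac{\delta L}{\delta u}=\frac{1}{\rho^3}\left[Dg\rho\rho_{xx}-Dg_{xx}\rho^2-2Dg\rho_x^2+2Dg_x\rho\rho_x-\rho^3(h_x\rho+g_xu+g_t)\right],$$ $$S_2=\frac{\delta L}{\delta \rho}=\frac{1}{\rho^2}\left[-h_xu\rho^2-Ag_x\rho+Dgu_{xx}-h_t\rho^2\right].$$ The system is called nonlinearly self-adjoint if there are nonzero functions $H(x,t,u,\rho)$ and $G(x,t,u,\rho)$ and coefficients $l_1,l_2,l_3,l_4$ (to be determined) such that, after the substitution $h=H(x,t,u,\rho)$, $g=G(x,t,u,\rho)$ (derivatives of $h,g$ becoming total derivatives of $H,G$),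 $$S_1\big|_{h=H,\,g=G}=l_1\mathbb{R}_1+l_2\mathbb{R}_2,\qquad S_2\big|_{h=H,\,g=G}=l_3\mathbb{R}_1+l_4\mathbb{R}_2 .$$ *)

(* Defs.v *)
From HB Require Import structures.
From mathcomp Require Import all_boot all_order all_algebra.
From mathcomp Require Import all_classical all_reals all_analysis.

Set Implicit Arguments.
Unset Strict Implicit.
Unset Printing Implicit Defensive.

Import Order.TTheory GRing.Theory Num.Theory.
Import numFieldNormedType.Exports.

Local Open Scope classical_set_scope.
Local Open Scope ring_scope.

(* The dependent variables: the unknowns u, rho of the system and the auxiliary
   variables h, g of the formal Lagrangian. *)
Inductive dvar := Vu | Vrho | Vh | Vg.

(* Coordinates of the infinite jet space. [Cd w (a, b)] stands for the
   derivative of w taken a times in x and b times in t. *)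
Inductive jcoord := Cx | Ct | Cd of dvar & nat * nat.

Lemma jcoord_eq_dec : comparable jcoord.
Proof. by rewrite /comparable /decidable; do !decide equality. Defined.

HB.instance Definition _ := hasDecEq.Build jcoord (compareP jcoord_eq_dec).

Notation cu := (Cd Vu (0%N, 0%N)).
Notation cu_x := (Cd Vu (1%N, 0%N)).
Notation cu_t := (Cd Vu (0%N, 1%N)).
Notation cu_xx := (Cd Vu (2%N, 0%N)).
Notation crho := (Cd Vrho (0%N, 0%N)).
Notation crho_x := (Cd Vrho (1%N, 0%N)).
Notation crho_t := (Cd Vrho (0%N, 1%N)).
Notation ch := (Cd Vh (0%N, 0%N)).
Notation cg := (Cd Vg (0%N, 0%N)).

Section JetCalculus.
Variable R : realType.

Definition jet := jcoord -> R.

Implicit Types (f : jet -> R) (j : jet).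

Definition upd j (c : jcoord) (s : R) : jet := fun c' => if c' == c then s else j c'.

Definition pd (c : jcoord) f : jet -> R := fun j => derive1 (fun s => f (upd j c s)) (j c).

(* The sums over multi-indices are finite-support sums: a differential function
   involves only finitely many coordinates. *)
Definition Dx f : jet -> R := fun j =>
  pd Cx f j + \sum_(w <- [:: Vu; Vrho; Vh; Vg])
    \sum_(a \in [set: nat * nat]) j (Cd w (a.1.+1, a.2)) * pd (Cd w a) f j.

Definition Dt f : jet -> R := fun j =>
  pd Ct f j + \sum_(w <- [:: Vu; Vrho; Vh; Vg])
    \sum_(a \in [set: nat * nat]) j (Cd w (a.1, a.2.+1)) * pd (Cd w a) f j.

Definition Dxt (a : nat * nat) f : jet -> R := iter a.1 Dx (iter a.2 Dt f).

Definition euler (w : dvar) f : jet -> R := fun j =>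
  \sum_(a \in [set: nat * nat]) (-1) ^+ (a.1 + a.2) * Dxt a (pd (Cd w a) f) j.

(* The jets at which the system is defined. *)
Definition regular j : Prop := j crho != 0.

(* C^oo, for S open: all iterated directional derivatives are differentiable. *)
Definition smooth_on n (S : set 'rV[R]_n) (F : 'rV[R]_n -> R^o) : Prop :=
  forall (vs : seq 'rV[R]_n) (p : 'rV[R]_n), S p ->
    differentiable (foldr (fun v G => 'D_v G) F vs) p.

Definition coords (cs : seq jcoord) j : 'rV[R]_(size cs) := \row_i j (nth Cx cs i).

Definition smooth_function_of (cs : seq jcoord) f : Prop :=
  exists2 F : 'rV[R]_(size cs) -> R^o,
    smooth_on [set p | exists2 j, regular j & p = coords cs j] F &
    forall j, f j = F (coords cs j).

Definition not_identically_zero f : Prop := exists2 j, regular j & f j != 0.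

Definition unknown_coord (c : jcoord) : bool :=
  match c with Cd Vh _ | Cd Vg _ => false | _ => true end.

(* A smooth function of x, t, u, rho and finitely many derivatives of u, rho. *)
Definition differential_function f : Prop :=
  exists cs : seq jcoord,
    [/\ uniq cs, all unknown_coord cs & smooth_function_of cs f].

Definition subst_hg (H G : jet -> R) f : jet -> R := fun j =>
  f (fun c => match c with
              | Cd Vh a => Dxt a H j
              | Cd Vg a => Dxt a G j
              | _ => j c
              end).

Definition lagrangian (R1 R2 : jet -> R) : jet -> R := fun j =>
  j ch * R1 j + j cg * R2 j.

Definition nonlinearly_self_adjoint (R1 R2 : jet -> R) : Prop :=
  exists H G l1 l2 l3 l4 : jet -> R,
  [/\ smooth_function_of [:: Cx; Ct; cu; crho] H /\ not_identically_zero H,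
      smooth_function_of [:: Cx; Ct; cu; crho] G /\ not_identically_zero G,
      [/\ differential_function l1, differential_function l2,
          differential_function l3 & differential_function l4] &
      forall j, regular j ->
        subst_hg H G (euler Vu (lagrangian R1 R2)) j = l1 j * R1 j + l2 j * R2 j /\
        subst_hg H G (euler Vrho (lagrangian R1 R2)) j = l3 j * R1 j + l4 j * R2 j].

Definition R1 : jet -> R := fun j =>
  j crho * j cu_x + j crho_x * j cu + j crho_t.

Definition R2 (A D : R) : jet -> R := fun j =>
  j cu_t + j cu * j cu_x + A * j crho_x / j crho - D * j cu_xx / j crho.

End JetCalculus.

Arguments R1 {R}.

(* Main.v *)
Require Import Defs.
From mathcomp Require Import all_boot all_order all_algebra.
From mathcomp Require Import all_classical all_reals all_analysis.
From mathcomp Require Import ring.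

(** The system is self-adjoint through the substitution [h = u], [g = rho].
    Write S1 and S2 for the Euler-Lagrange expressions of the formal Lagrangian
    with respect to u and rho.  Integrating by parts,
      S1 = - h_x rho - g_t - u g_x - D (g / rho)_xx,
      S2 = - h_t - u h_x - A g_x / rho + D g u_xx / rho ^ 2
    ([adjoint_u], [adjoint_rho]).  The term (g / rho)_xx involves rho_xx, which
    occurs in neither equation of the system; the choice [g = rho] removes it.
    With [h = u] what remains is S1 = - R1 and S2 = - R2, so the coefficients
    are the constants l1 = l4 = -1 and l2 = l3 = 0.

    The work lies in evaluating [euler], which is built from analytic
    derivatives and from sums over all multi-indices.  Everything that occurs is
    a polynomial in jet coordinates and [1 / rho], so it is the value of a term
    of a small syntax [expr], on which derivations are computed symbolically.
    The symbolic derivation is correct at jets with [rho != 0]: for partial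
    derivatives by the usual rules of calculus ([pd_eval]), for total
    derivatives by the chain rule over the finitely many multi-indices of the
    term ([total_eval]), and hence for the Euler operator ([euler_eval]).
    These statements speak of any function that agrees with the term on regular
    jets, because this weak form of agreement survives differentiation
    (regularity is an open condition) and can thus be iterated.  The theorem is
    then an identity of rational functions. *)

Set Implicit Arguments.
Unset Strict Implicit.
Unset Printing Implicit Defensive.

Import Order.TTheory GRing.Theory Num.Theory.
Import numFieldNormedType.Exports.

Local Open Scope classical_set_scope.
Local Open Scope ring_scope.

(** * Symbolic derivations *)

Section Symbolic.
Variable R : realType.
Implicit Types (j : jet R) (c : jcoord) (w : dvar) (a : nat * nat).

Inductive expr :=
  | Coord of jcoord
  | Const of R
  | InvRho
  | Add of expr & expr
  | Mul of expr & expr.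

Fixpoint eval (e : expr) : jet R -> R := fun j =>
  match e with
  | Coord c => j c
  | Const r => r
  | InvRho => (j crho)^-1
  | Add e1 e2 => eval e1 j + eval e2 j
  | Mul e1 e2 => eval e1 j * eval e2 j
  end.

(** A derivation is determined by its values [d] on the coordinates, so that
    partial and total derivatives are instances of a single recursion. *)
Fixpoint deriv (d : jcoord -> expr) (e : expr) : expr :=
  match e with
  | Coord c => d c
  | Const _ => Const 0
  | InvRho => Mul (Const (-1)) (Mul (d crho) (Mul InvRho InvRho))
  | Add e1 e2 => Add (deriv d e1) (deriv d e2)
  | Mul e1 e2 => Add (Mul (deriv d e1) e2) (Mul e1 (deriv d e2))
  end.

Definition partial c : expr -> expr := deriv (fun c' => Const (c == c')%:R).

(** [c0] is the independent variable of the total derivative and [sft] its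
    action on multi-indices. *)
Definition total_symb c0 (sft : nat * nat -> nat * nat) : expr -> expr :=
  deriv (fun c => if c is Cd w a then Coord (Cd w (sft a))
                  else Const (c0 == c)%:R).

Definition shiftx a := (a.1.+1, a.2).
Definition shiftt a := (a.1, a.2.+1).

Definition Dxt_symb a (e : expr) : expr :=
  iter a.1 (total_symb Cx shiftx) (iter a.2 (total_symb Ct shiftt) e).

Fixpoint indices (e : expr) : seq (nat * nat) :=
  match e with
  | Coord (Cd _ a) => [:: a]
  | Coord _ | Const _ => [::]
  | InvRho => [:: (0, 0)%N]
  | Add e1 e2 | Mul e1 e2 => indices e1 ++ indices e2
  end.

(** Nothing is asked at singular jets, where the derivatives of [1 / rho] do not
    follow the rules of calculus. *)
Definition represents (f : jet R -> R) (e : expr) :=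
  forall j, regular j -> f j = eval e j.

(** * Partial derivatives *)

Lemma upd_id j c : upd j c (j c) = j.
Proof. by apply/funext => c'; rewrite /upd; case: eqP => [->|]. Qed.

(** Perturbing one coordinate leaves the jet regular, so the values at singular
    jets do not influence partial derivatives at regular ones. *)
Lemma regular_near j c : regular j -> \forall s \near j c, regular (upd j c s).
Proof.
move=> rj; rewrite /regular /upd; case: (crho =P c) => [<-|_].
  by apply: (@cvgr_neq0 R R^o R (nbhs (j crho)) _ id (j crho)); [exact: cvg_id|].
by near=> s.
Unshelve. all: by end_near. Qed.

Lemma eval_is_derive e j c : regular j ->
  is_derive (j c) (1 : R) (fun s => eval e (upd j c s) : R)
            (eval (partial c e) j).
Proof.
move=> rj; have coordP c' :
    is_derive (j c) (1 : R) (fun s => upd j c s c' : R) ((c == c')%:R).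
  rewrite /upd eq_sym; case: (c == c') => /=; first exact: is_derive_id.
  exact: is_derive_cst.
elim: e => [c'|r||e1 IH1 e2 IH2|e1 IH1 e2 IH2] /=.
- exact: coordP.
- exact: is_derive_cst.
- have rho0 : upd j c (j c) crho != 0 by rewrite upd_id.
  apply: is_derive_eq (is_deriveV rho0 (coordP crho)) _.
  by rewrite upd_id /GRing.scale /= expr2 invfM; ring.
- exact: is_deriveD.
- apply: is_derive_eq (is_deriveM IH1 IH2) _.
  by rewrite upd_id /GRing.scale /=; ring.
Qed.

Lemma pd_eval f e c : represents f e -> represents (pd c f) (partial c e).
Proof.
move=> fe j rj; rewrite /pd derive1E.
rewrite (near_eq_derive (g := fun s => eval e (upd j c s))).
  by have := eval_is_derive e c rj => H; rewrite derive_val.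
by near do apply: fe; exact: regular_near.
Unshelve. all: by end_near. Qed.

(** This is what makes the sums over all multi-indices finite. *)
Lemma partial_notin e w a j :
  a \notin indices e -> eval (partial (Cd w a) e) j = 0.
Proof.
have neq w' a' : a \notin [:: a'] -> (Cd w a == Cd w' a') = false.
  by rewrite inE; apply: contraNF => /eqP[_ ->].
elim: e => [[||w' a']|r||e1 IH1 e2 IH2|e1 IH1 e2 IH2] //=.
- by move=> ?; rewrite neq.
- by move=> ?; rewrite neq // mul0r mulr0.
- by rewrite mem_cat negb_or => /andP[? ?]; rewrite IH1 // IH2 // addr0.
- rewrite mem_cat negb_or => /andP[? ?]; rewrite IH1 // IH2 //.
  by rewrite mul0r mulr0 addr0.
Qed.

(** * Total derivatives *)

(** The common form of [Dx] and [Dt], to which both are convertible. *)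
Definition total c0 (sft : nat * nat -> nat * nat) (f : jet R -> R) : jet R -> R :=
  fun j => pd c0 f j + \sum_(w <- [:: Vu; Vrho; Vh; Vg])
    \sum_(a \in [set: nat * nat]) j (Cd w (sft a)) * pd (Cd w a) f j.

Lemma fsum_finite_support (s : seq (nat * nat)) (F : nat * nat -> R) :
  uniq s -> (forall a, a \notin s -> F a = 0) ->
  \sum_(a \in [set: nat * nat]) F a = \sum_(a <- s) F a.
Proof.
move=> us F0; rewrite (fsbigE s) //; last by move=> a _; exact: F0.
by apply: eq_bigl => a; rewrite in_setT.
Qed.

Lemma sum_linear (s : seq (nat * nat)) (k l : R) (W F G : dvar -> nat * nat -> R) :
  \sum_(w <- [:: Vu; Vrho; Vh; Vg]) \sum_(a <- s) W w a * (k * F w a + l * G w a) =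
  k * (\sum_(w <- [:: Vu; Vrho; Vh; Vg]) \sum_(a <- s) W w a * F w a) +
  l * (\sum_(w <- [:: Vu; Vrho; Vh; Vg]) \sum_(a <- s) W w a * G w a).
Proof.
rewrite !big_distrr -big_split /=; apply: eq_bigr => w _.
rewrite !big_distrr -big_split /=; apply: eq_bigr => a _; ring.
Qed.

Lemma sum_delta (s : seq (nat * nat)) (W : dvar -> nat * nat -> R) w a :
  uniq s -> a \in s ->
  \sum_(w' <- [:: Vu; Vrho; Vh; Vg]) \sum_(a' <- s)
    W w' a' * (Cd w' a' == Cd w a)%:R = W w a.
Proof.
move=> us sa.
have same : \sum_(a' <- s) W w a' * (Cd w a' == Cd w a)%:R = W w a.
  rewrite (bigD1_seq a) //= eqxx mulr1 big1 ?addr0 // => a' neq.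
  by rewrite (_ : _ == _ = false) ?mulr0 //; apply: contraNF neq => /eqP[->].
have diff w' : w' <> w -> \sum_(a' <- s) W w' a' * (Cd w' a' == Cd w a)%:R = 0.
  move=> neq; apply: big1 => a' _.
  by rewrite (_ : _ == _ = false) ?mulr0 //; apply/eqP => -[/neq].
rewrite !big_cons big_nil.
by case: w same diff => -> diff; rewrite !diff // !(addr0, add0r).
Qed.

(** The chain rule: a derivation is the combination of the partial derivatives
    weighted by its values on the coordinates. *)
Lemma chain_rule c0 sft e (s : seq (nat * nat)) j :
  (forall w a, c0 <> Cd w a) -> uniq s -> {subset indices e <= s} ->
  eval (partial c0 e) j + \sum_(w <- [:: Vu; Vrho; Vh; Vg]) \sum_(a <- s)
    j (Cd w (sft a)) * eval (partial (Cd w a) e) j = eval (total_symb c0 sft e) j.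
Proof.
move=> c0P us.
have coordP w a : a \in s -> (c0 == Cd w a)%:R + \sum_(w' <- [:: Vu; Vrho; Vh; Vg])
    \sum_(a' <- s) j (Cd w' (sft a')) * (Cd w' a' == Cd w a)%:R = j (Cd w (sft a)).
  move=> sa; rewrite (sum_delta (fun w a => j (Cd w (sft a)))) //.
  by rewrite (negbTE (introN eqP (c0P w a))) add0r.
have sum0 (F : dvar -> nat * nat -> R) : (forall w a, F w a = 0) ->
    \sum_(w <- [:: Vu; Vrho; Vh; Vg]) \sum_(a <- s) j (Cd w (sft a)) * F w a = 0.
  by move=> F0; rewrite big1 // => w _; rewrite big1 // => a _; rewrite F0 mulr0.
elim: e => [[||w a]|r||e1 IH1 e2 IH2|e1 IH1 e2 IH2] /= sub.
- by rewrite sum0 ?addr0.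
- by rewrite sum0 ?addr0.
- by rewrite coordP // sub ?inE.
- by rewrite sum0 ?addr0.
(* The term [1 / rho] reduces to the coordinate [rho], with an overall factor. *)
- have /(coordP Vrho) <- : (0, 0)%N \in s by rewrite sub ?inE.
  have -> : \sum_(w <- [:: Vu; Vrho; Vh; Vg]) \sum_(a <- s) j (Cd w (sft a)) *
      (-1 * ((Cd w a == crho)%:R * ((j crho)^-1 * (j crho)^-1))) =
      -1 * (\sum_(w <- [:: Vu; Vrho; Vh; Vg]) \sum_(a <- s)
        j (Cd w (sft a)) * (Cd w a == crho)%:R) * ((j crho)^-1 * (j crho)^-1).
    rewrite big_distrr big_distrl /=; apply: eq_bigr => w _.
    by rewrite big_distrr big_distrl /=; apply: eq_bigr => a _; ring.
  by ring.
- have sub1 : {subset indices e1 <= s} by move=> a ?; rewrite sub // mem_cat; apply/orP; left.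
  have sub2 : {subset indices e2 <= s} by move=> a ?; rewrite sub // mem_cat; apply/orP; right.
  rewrite -(IH1 sub1) -(IH2 sub2).
  (* The coefficients [1] bring the sum into the form of [sum_linear]. *)
  under eq_bigr do under eq_bigr do
    rewrite -[eval _ _]mul1r -[X in _ + X]mul1r.
  by rewrite sum_linear; ring.
- have sub1 : {subset indices e1 <= s} by move=> a ?; rewrite sub // mem_cat; apply/orP; left.
  have sub2 : {subset indices e2 <= s} by move=> a ?; rewrite sub // mem_cat; apply/orP; right.
  rewrite -(IH1 sub1) -(IH2 sub2).
  under eq_bigr do under eq_bigr do rewrite [X in X + _]mulrC.
  by rewrite sum_linear; ring.
Qed.

Lemma total_eval c0 sft f e : (forall w a, c0 <> Cd w a) ->
  represents f e -> represents (total c0 sft f) (total_symb c0 sft e).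
Proof.
move=> c0P fe j rj; pose s := undup (indices e).
have us : uniq s by exact: undup_uniq.
rewrite -(@chain_rule c0 sft e s j) //; last by move=> a; rewrite mem_undup.
rewrite /total (pd_eval _ fe) //; congr (_ + _).
apply: eq_bigr => w _; rewrite (fsum_finite_support us) => [|a].
  by apply: eq_bigr => a _; rewrite (pd_eval _ fe).
by rewrite mem_undup (pd_eval _ fe) // => ?; rewrite partial_notin ?mulr0.
Qed.

Lemma Dxt_eval a f e : represents f e -> represents (Dxt a f) (Dxt_symb a e).
Proof.
move=> fe; rewrite /Dxt /Dxt_symb.
have : represents (iter a.2 (@Dt R) f) (iter a.2 (total_symb Ct shiftt) e).
  by elim: a.2 => [|n IH] //=; exact: (@total_eval Ct shiftt).
move: (iter a.2 _ f) (iter a.2 _ e) => g e' ge.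
by elim: a.1 => [|n IH] //=; exact: (@total_eval Cx shiftx).
Qed.

Lemma Dxt_symb_coord w a : Dxt_symb a (Coord (Cd w (0, 0)%N)) = Coord (Cd w a).
Proof.
case: a => m n; rewrite /Dxt_symb /=.
have -> : iter n (total_symb Ct shiftt) (Coord (Cd w (0, 0)%N)) = Coord (Cd w (0, n)%N).
  by elim: n => //= n ->.
by elim: m => //= m ->.
Qed.

Lemma Dxt_coord w a j : regular j ->
  Dxt a (fun j' => j' (Cd w (0, 0)%N)) j = j (Cd w a).
Proof.
by move=> rj; rewrite (@Dxt_eval a _ (Coord (Cd w (0, 0)%N))) // Dxt_symb_coord.
Qed.

(** * The Euler operator *)

Lemma Dxt_zero a f : represents f (Const 0) -> represents (Dxt a f) (Const 0).
Proof.
move=> f0 j rj; rewrite (Dxt_eval a f0) // /Dxt_symb.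
have iter0 n c0 sft : iter n (total_symb c0 sft) (Const 0) = Const 0.
  by elim: n => //= n ->.
by rewrite !iter0.
Qed.

(** A multi-index absent from the term contributes the total derivatives of a
    function that vanishes on regular jets.  The hypothesis on [s] is boolean so
    that it is decided by computation on concrete terms. *)
Lemma euler_eval w f e (s : seq (nat * nat)) j :
  uniq s -> all (mem s) (indices e) -> represents f e -> regular j ->
  euler w f j = \sum_(a <- s) (-1) ^+ (a.1 + a.2) *
                  eval (Dxt_symb a (partial (Cd w a) e)) j.
Proof.
move=> us /allP sub fe rj; rewrite /euler (fsum_finite_support us) => [|a sa].
  by apply: eq_bigr => a _; rewrite (Dxt_eval a (pd_eval (Cd w a) fe)).
rewrite (@Dxt_zero a (pd (Cd w a) f)) ?mulr0 // => j' rj'.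
by rewrite (pd_eval _ fe) // partial_notin //; apply: contra sa => /sub.
Qed.

(** * Smoothness of the substitution *)

Lemma smooth_coord (cs : seq jcoord) (i : 'I_(size cs)) :
  smooth_function_of cs (fun j : jet R => j (nth Cx cs i)).
Proof.
pose F : 'rV[R]_(size cs) -> R^o := fun p => p 0 i.
exists F; last by move=> j; rewrite /F mxE.
move=> vs p _; set G := foldr _ _ _.
(* Iterated derivatives of a linear form are that form itself or constants. *)
have [->|[k ->]] : G = F \/ exists k : R^o, G = cst k.
- rewrite {p}/G; elim: vs => [|v vs /= [->|[k ->]]]; [by left| right | right].
    exists (v 0 i); apply/funext => q; rewrite /derive.
    apply: cvg_lim => //; apply: cvg_near_cst; near=> h.
    have h0 : h != 0 by near: h; exact: nbhs_dnbhs_neq.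
    by rewrite /F /= !mxE addrK /GRing.scale /= mulKf.
  by exists 0; apply/funext => q; rewrite derive_cst.
- exact: differentiable_coord.
- exact: differentiable_cst.
Unshelve. all: by end_near. Qed.

Lemma differential_function_cst (k : R) : differential_function (fun _ : jet R => k).
Proof.
exists [::]; split=> //; exists (cst k) => // vs p _.
set G := foldr _ _ _.
have [l ->] : exists l : R^o, G = cst l.
  rewrite {p}/G; elim: vs => [|v vs /= [l ->]]; first by exists k.
  by exists 0; apply/funext => q; rewrite derive_cst.
exact: differentiable_cst.
Qed.

Lemma coord_not_identically_zero c : not_identically_zero (fun j : jet R => j c).
Proof. by exists (fun=> 1); rewrite /regular oner_eq0. Qed.

(** * The system *)

Definition lagrangian_expr (A D : R) : expr :=
  Add (Mul (Coord ch) (Add (Add (Mul (Coord crho) (Coord cu_x))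
                                (Mul (Coord crho_x) (Coord cu)))
                           (Coord crho_t)))
      (Mul (Coord cg) (Add (Add (Add (Coord cu_t) (Mul (Coord cu) (Coord cu_x)))
                                (Mul (Mul (Const A) (Coord crho_x)) InvRho))
                           (Mul (Mul (Const (- D)) (Coord cu_xx)) InvRho))).

Lemma lagrangian_represents A D :
  represents (lagrangian R1 (R2 A D)) (lagrangian_expr A D).
Proof. by move=> j _; rewrite /lagrangian /R1 /R2 /= !mulNr. Qed.

Lemma euler_lagrangian A D w j : regular j ->
  euler w (lagrangian R1 (R2 A D)) j =
  \sum_(a <- [:: (0, 0); (1, 0); (0, 1); (2, 0)]%N) (-1) ^+ (a.1 + a.2) *
     eval (Dxt_symb a (partial (Cd w a) (lagrangian_expr A D))) j.
Proof. by move=> rj; apply: euler_eval => //; exact: lagrangian_represents. Qed.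

Notation ch_x := (Cd Vh (1%N, 0%N)).
Notation ch_t := (Cd Vh (0%N, 1%N)).
Notation cg_x := (Cd Vg (1%N, 0%N)).
Notation cg_t := (Cd Vg (0%N, 1%N)).
Notation cg_xx := (Cd Vg (2%N, 0%N)).
Notation crho_xx := (Cd Vrho (2%N, 0%N)).

Lemma adjoint_u A D j : regular j ->
  euler Vu (lagrangian R1 (R2 A D)) j =
  (D * j cg * j crho * j crho_xx - D * j cg_xx * j crho ^+ 2
   - 2 * D * j cg * j crho_x ^+ 2 + 2 * D * j cg_x * j crho * j crho_x
   - j crho ^+ 3 * (j ch_x * j crho + j cg_x * j cu + j cg_t)) / j crho ^+ 3.
Proof.
move=> rj; rewrite euler_lagrangian // !big_cons big_nil /= /shiftx /shiftt /=.
by rewrite !(mul0r, mulr0, mulr1, mul1r, add0r, addr0); field.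
Qed.

Lemma adjoint_rho A D j : regular j ->
  euler Vrho (lagrangian R1 (R2 A D)) j =
  (- j ch_x * j cu * j crho ^+ 2 - A * j cg_x * j crho + D * j cg * j cu_xx
   - j ch_t * j crho ^+ 2) / j crho ^+ 2.
Proof.
move=> rj; rewrite euler_lagrangian // !big_cons big_nil /= /shiftx /shiftt /=.
by rewrite !(mul0r, mulr0, mulr1, mul1r, add0r, addr0); field.
Qed.

(** The total derivatives of the coordinates u and rho are again coordinates, so
    the substitution [h = u], [g = rho] is a relabelling of the jet. *)
Lemma subst_u_rho (f : jet R -> R) j : regular j ->
  subst_hg (fun j => j cu) (fun j => j crho) f j =
  f (fun c => match c with
              | Cd Vh a => j (Cd Vu a)
              | Cd Vg a => j (Cd Vrho a)
              | _ => j c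
              end).
Proof.
move=> rj; rewrite /subst_hg; congr f; apply/funext => -[||[] a] //;
  exact: Dxt_coord.
Qed.

End Symbolic.

Theorem theorem5p1 (R : realType) (A D : R) :
  nonlinearly_self_adjoint R1 (R2 A D).
Proof.
exists (fun j => j cu), (fun j => j crho).
exists (fun=> -1), (fun=> 0), (fun=> 0), (fun=> -1); split.
- split; last exact: coord_not_identically_zero.
  exact: (@smooth_coord R [:: Cx; Ct; cu; crho] (@Ordinal 4 2 isT)).
- split; last exact: coord_not_identically_zero.
  exact: (@smooth_coord R [:: Cx; Ct; cu; crho] (@Ordinal 4 3 isT)).
- by split; exact: differential_function_cst.
move=> j rj; rewrite !subst_u_rho // adjoint_u // adjoint_rho // /R1 /R2.
by split; field.
Qed.
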